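(* Assume that a single impulse is applied at time $\tau\in[0,T]$ to the Erlang-A fluid system $$\frac{dq}{dt}(t)=\lambda-\mu\,(q(t)\wedge c)-\theta\,(q(t)-c)^+\quad (t\neq\tau),\qquad q(\tau^+)-q(\tau^-)=(b-1)\,q(\tau^-),$$ with constant arrival rate $\lambda$ and constant service rate $\mu$, and initial condition $q(0)=q_0$. Denote the steady state means $\xi_1=\frac{\lambda-\mu c+\theta c}{\theta}$ and $\xi_2=\frac{\lambda}{\mu}$. Let $J(\tau)=\frac1T\int_0^T q(t)\,dt$ be the average queue length. Then the optimal jumping time $\tau_U^*=\mathrm{argmax}_{\tau\in[0,T]}J(\tau)$ maximizing the average queue length $J(\tau)$ is equal to $T$.
   Context: $q(t)$ is the fluid queue length at time $t$, $\lambda$ is the arrival rate, $\mu$ the service rate, $\theta$ the abandonment rate, $c$ the number of servers, and $b$ the jump parameter (the impulse multiplies the queue length by $b$). Notation: $x\wedge y=\min(x,y)$, $x^+=\max(x,0)$; $q(\tau^-)$ and $q(\tau^+)$ are the values just before and just after the impulse. If $\tau=0$ the impulse is applied to the initial value $q_0$ (so $q(0^+)=b q_0$); if $\tau=T$ the impulse does not affect the integral.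
   Formalization: The jump parameter is assumed to satisfy b < 1 (for b > 1 an earlier impulse raises J, so the claim fails; for b = 1, J is constant), and when q_0 = 0 the time τ = 0 is allowed to tie with T as maximizer. *)

(* Defs.v *)
From Stdlib Require Import Reals.
From Coquelicot Require Import Coquelicot.
Open Scope R_scope.

Definition erlangA_drift (lam mu theta c x : R) : R :=
  lam - mu * Rmin x c - theta * Rmax (x - c) 0.

(* The value just before time [t]. Trajectories start at time 0, so at [t = 0]
   it is the initial value [q 0]. *)
Definition is_value_before (q : R -> R) (t l : R) : Prop :=
  (t = 0 -> l = q 0) /\ (0 < t -> filterlim q (at_left t) (locally l)).

Definition is_value_after (q : R -> R) (t l : R) : Prop :=
  filterlim q (at_right t) (locally l).

(* [q] solves the fluid system on [0, +oo) with a single impulse at [tau].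
   The value of [q] at an impulse time [tau > 0] is left free, as is its
   behaviour at negative times. If [tau = 0], then [q 0 = q0] is the value
   before the impulse, and [is_value_after q 0 (b * q0)] by [traj_jump]. *)
Record impulse_trajectory (lam mu theta c b q0 tau : R) (q : R -> R) : Prop := {
  traj_init : q 0 = q0;
  traj_start : 0 < tau -> is_value_after q 0 (q 0);
  traj_ode : forall t, 0 < t -> t <> tau ->
    is_derive q t (erlangA_drift lam mu theta c (q t));
  traj_jump : exists qm qp,
    is_value_before q tau qm /\ is_value_after q tau qp /\
    qp - qm = (b - 1) * qm
}.

Definition average (T : R) (q : R -> R) : R := / T * RInt q 0 T.

Definition is_argmax (D : R -> Prop) (J : R -> R) (s : R) : Prop :=
  D s /\ forall t, D t -> J t <= J s.

(* Main.v *)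
(* Before [tau] the trajectories with impulses at [tau] and at [T] agree. The
   queue [x] just before [tau] is nonnegative, so the impulse lowers it to
   [b x <= x]. Since the drift is nonincreasing in the state, this order
   persists up to [T], and since the drift is Lipschitz the gap can shrink at
   most exponentially, so it stays positive whenever [x > 0]. *)
Require Import Defs.
From Stdlib Require Import Reals Lra.
From Coquelicot Require Import Coquelicot.
Open Scope R_scope.

(** * Calculus preliminaries: the squared negative part and one-sided limits *)

(** Squaring smooths the corner of [Rmin x 0] at 0, which gives a differentiable measure of how far
    a function lies below zero. *)
Lemma is_derive_sqr_neg_part (y : R) :
  is_derive (fun x => (Rmin x 0) ^ 2) y (2 * Rmin y 0).
Proof.
apply is_derive_Reals; intros eps Heps.
(* The first-order remainder is at most [d * d] in every sign case, so the difference quotient errs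
   by at most [Rabs d] and [eps] itself serves as the radius. *)
exists (mkposreal eps Heps); intros d Hd Hde; simpl in Hde.
assert (Hq : Rabs ((Rmin (y + d) 0) ^ 2 - (Rmin y 0) ^ 2 - 2 * Rmin y 0 * d)
             <= Rabs d * Rabs d).
{ rewrite <- Rabs_mult, (Rabs_pos_eq (d * d)) by nra.
  unfold Rmin; destruct (Rle_dec (y + d) 0), (Rle_dec y 0);
    apply Rabs_le; split; nra. }
replace (_ / d - _)
  with (((Rmin (y + d) 0) ^ 2 - (Rmin y 0) ^ 2 - 2 * Rmin y 0 * d) / d)
  by (field; exact Hd).
unfold Rdiv; rewrite Rabs_mult, Rabs_inv.
assert (Hd0 : 0 < Rabs d) by (apply Rabs_pos_lt; exact Hd).
apply Rle_lt_trans with (2 := Hde).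
apply Rmult_le_reg_r with (1 := Hd0).
rewrite Rmult_assoc, Rinv_l by lra; lra.
Qed.

Lemma at_right_interval (a b : R) (P : R -> Prop) :
  a < b -> (forall t, a < t < b -> P t) -> at_right a P.
Proof.
intros Hab HP.
exists (mkposreal (b - a) ltac:(lra)); intros t Ht Hat.
apply HP; split; [exact Hat |].
apply Rabs_lt_between' in Ht; simpl in Ht; lra.
Qed.

Lemma at_left_interval (a b : R) (P : R -> Prop) :
  a < b -> (forall t, a < t < b -> P t) -> at_left b P.
Proof.
intros Hab HP.
exists (mkposreal (b - a) ltac:(lra)); intros t Ht Htb.
apply HP; split; [| exact Htb].
apply Rabs_lt_between' in Ht; simpl in Ht; lra.
Qed.

Lemma continuous_at_right (f : R -> R) (x : R) :
  continuous f x -> filterlim f (at_right x) (locally (f x)).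
Proof.
apply filterlim_filter_le_1; intros P; apply filter_le_within.
Qed.

Lemma continuous_at_left (f : R -> R) (x : R) :
  continuous f x -> filterlim f (at_left x) (locally (f x)).
Proof.
apply filterlim_filter_le_1; intros P; apply filter_le_within.
Qed.

Lemma is_derive_continuous (f : R -> R) (x l : R) :
  is_derive f x l -> continuous f x.
Proof.
intros Hf; apply (ex_derive_continuous f); exists l; exact Hf.
Qed.

(** * Differential inequalities started from a right limit *)

(** The mean value theorem gives [g s <= g t] for [s] in [(a, t)]; then [s] tends to [a]. Only the
    right limit at [a] enters, so the result applies just after an impulse. *)
Lemma right_limit_le_of_derive_nonneg (g dg : R -> R) (a b l : R) :
  (forall t, a < t < b -> is_derive g t (dg t)) ->
  (forall t, a < t < b -> 0 <= dg t) ->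
  filterlim g (at_right a) (locally l) ->
  forall t, a < t < b -> l <= g t.
Proof.
intros Hd Hpos Hl t Ht.
change (Rbar_le l (g t)).
apply (@filterlim_le R (at_right a) _ g (fun _ => g t)).
- apply at_right_interval with t; [lra |]; intros s Hs.
  destruct (MVT_gen g s t dg) as [x [Hx Heq]].
  + rewrite Rmin_left, Rmax_right by lra; intros x Hx; apply Hd; lra.
  + rewrite Rmin_left, Rmax_right by lra; intros x Hx.
    apply continuity_pt_filterlim, (is_derive_continuous g x (dg x)), Hd; lra.
  + rewrite Rmin_left, Rmax_right in Hx by lra.
    assert (0 <= dg x) by (apply Hpos; lra); nra.
- exact Hl.
- apply filterlim_const.
Qed.

(** The function [- (Rmin (w t) 0) ^ 2] is nondecreasing: its derivative vanishes where [w] is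
    positive and is nonnegative elsewhere. It starts from the limit 0 and is never positive, so it
    stays 0. This replaces an argument by first crossing times. *)
Lemma nonneg_of_derive_nonneg_below (w dw : R -> R) (a b l : R) :
  (forall t, a < t < b -> is_derive w t (dw t)) ->
  (forall t, a < t < b -> w t <= 0 -> 0 <= dw t) ->
  filterlim w (at_right a) (locally l) -> 0 <= l ->
  forall t, a < t < b -> 0 <= w t.
Proof.
intros Hd Hpos Hl Hl0 t Ht.
assert (H : - (Rmin l 0) ^ 2 <= - (Rmin (w t) 0) ^ 2).
{ apply (right_limit_le_of_derive_nonneg (fun s => - (Rmin (w s) 0) ^ 2)
           (fun s => - (dw s * (2 * Rmin (w s) 0))) a b); [| | | exact Ht].
  - intros s Hs; apply (is_derive_opp (fun s => (Rmin (w s) 0) ^ 2)).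
    apply (is_derive_comp (fun x => (Rmin x 0) ^ 2) w).
    + apply is_derive_sqr_neg_part.
    + apply Hd; exact Hs.
  - intros s Hs; specialize (Hpos s Hs).
    unfold Rmin; destruct (Rle_dec (w s) 0) as [Hw | Hw]; [| lra].
    specialize (Hpos Hw); nra.
  - apply (filterlim_comp _ _ _ w (fun x => - (Rmin x 0) ^ 2) _ (locally l));
      [exact Hl |].
    apply (is_derive_continuous (fun x => - (Rmin x 0) ^ 2) l (- (2 * Rmin l 0))).
    apply (is_derive_opp (fun x => (Rmin x 0) ^ 2)), is_derive_sqr_neg_part. }
rewrite (Rmin_right l 0) in H by lra.
unfold Rmin in H; destruct (Rle_dec (w t) 0); nra.
Qed.

(** Gronwall's argument: with the integrating factor [exp (L * t)], the product [exp (L * t) * w t]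
    is nondecreasing and starts from a positive limit. *)
Lemma pos_of_derive_ge_linear (w dw : R -> R) (L a b l : R) :
  (forall t, a < t < b -> is_derive w t (dw t)) ->
  (forall t, a < t < b -> 0 <= L * w t + dw t) ->
  filterlim w (at_right a) (locally l) -> 0 < l ->
  forall t, a < t < b -> 0 < w t.
Proof.
intros Hd Hpos Hl Hl0 t Ht.
assert (H : exp (L * a) * l <= exp (L * t) * w t).
{ apply (right_limit_le_of_derive_nonneg (fun s => exp (L * s) * w s)
           (fun s => exp (L * s) * (L * w s + dw s)) a b); [| | | exact Ht].
  - intros s Hs; specialize (Hd s Hs).
    auto_derive; [exists (dw s); exact Hd |].
    replace (Derive (fun x => w x) s) with (dw s)
      by (symmetry; exact (is_derive_unique w s _ Hd)).
    ring.
  - intros s Hs; apply Rmult_le_pos; [left; apply exp_pos | auto].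
  - apply (filterlim_comp_2 (G := locally (exp (L * a))) (H := locally l)
             (fun s => exp (L * s)) w Rmult).
    + apply (continuous_at_right (fun s => exp (L * s))).
      apply (ex_derive_continuous (fun s => exp (L * s))).
      auto_derive; exact I.
    + exact Hl.
    + apply (filterlim_mult (exp (L * a)) l). }
assert (0 < exp (L * a)) by apply exp_pos.
assert (0 < exp (L * t)) by apply exp_pos.
nra.
Qed.

Lemma filterlim_Rminus (u v : R -> R) (F : (R -> Prop) -> Prop)
    {FF : Filter F} (lu lv : R) :
  filterlim u F (locally lu) -> filterlim v F (locally lv) ->
  filterlim (fun t => u t - v t) F (locally (lu - lv)).
Proof.
intros Hu Hv.
apply (filterlim_comp_2 (G := locally lu) (H := locally (- lv))
         u (fun t => - v t) Rplus).
- exact Hu.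
- apply (filterlim_comp _ _ _ v Ropp _ (locally lv)); [exact Hv |].
  apply (filterlim_opp lv).
- apply (filterlim_plus lu (- lv)).
Qed.

(** Wherever the supersolution [u] is below the subsolution [v], monotonicity of [f] gives
    [dv <= f v <= f u <= du], so [u - v] has a nonnegative derivative exactly where a violation
    could grow. *)
Lemma ode_comparison (f u du v dv : R -> R) (a b lu lv : R) :
  (forall x y, x <= y -> f y <= f x) ->
  (forall t, a < t < b -> is_derive u t (du t)) ->
  (forall t, a < t < b -> f (u t) <= du t) ->
  (forall t, a < t < b -> is_derive v t (dv t)) ->
  (forall t, a < t < b -> dv t <= f (v t)) ->
  filterlim u (at_right a) (locally lu) ->
  filterlim v (at_right a) (locally lv) ->
  lv <= lu ->
  forall t, a < t < b -> v t <= u t.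
Proof.
intros Hf Hu Hdu Hv Hdv Hlu Hlv Hle t Ht.
enough (0 <= u t - v t) by lra.
apply (nonneg_of_derive_nonneg_below (fun s => u s - v s)
         (fun s => du s - dv s) a b (lu - lv)); [| | | lra | exact Ht].
- intros s Hs; apply (is_derive_minus u v); auto.
- intros s Hs Hw.
  assert (f (v s) <= f (u s)) by (apply Hf; lra).
  specialize (Hdu s Hs); specialize (Hdv s Hs); lra.
- apply filterlim_Rminus; auto; typeclasses eauto.
Qed.

(** The weak comparison orders the solutions; the one-sided Lipschitz bound then shows that the gap
    decays no faster than [exp (- L * t)]. *)
Lemma ode_comparison_strict (f u v : R -> R) (L a b lu lv : R) :
  (forall x y, x <= y -> f y <= f x) ->
  (forall x y, x <= y -> f x - f y <= L * (y - x)) ->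
  (forall t, a < t < b -> is_derive u t (f (u t))) ->
  (forall t, a < t < b -> is_derive v t (f (v t))) ->
  filterlim u (at_right a) (locally lu) ->
  filterlim v (at_right a) (locally lv) ->
  lv < lu ->
  forall t, a < t < b -> v t < u t.
Proof.
intros Hf HL Hu Hv Hlu Hlv Hlt t Ht.
enough (0 < u t - v t) by lra.
apply (pos_of_derive_ge_linear (fun s => u s - v s)
         (fun s => f (u s) - f (v s)) L a b (lu - lv)); [| | | lra | exact Ht].
- intros s Hs; apply (is_derive_minus u v); auto.
- intros s Hs.
  assert (Hle : v s <= u s).
  { apply (ode_comparison f u (fun s => f (u s)) v (fun s => f (v s))
             a b lu lv); auto; intros; lra. }
  specialize (HL _ _ Hle); lra.
- apply filterlim_Rminus; auto; typeclasses eauto.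
Qed.

(** * Integrals of functions known only through their limits at the endpoints *)

Lemma ex_RInt_of_limits (f : R -> R) (a b la lb : R) :
  a < b ->
  (forall t, a < t < b -> continuous f t) ->
  filterlim f (at_right a) (locally la) ->
  filterlim f (at_left b) (locally lb) ->
  ex_RInt f a b.
Proof.
intros Hab Hf Ha Hb.
destruct (C0_extension_lt f la lb a b Hab Hf Ha Hb) as [g [Hg [Heq _]]].
apply ex_RInt_ext with g.
- rewrite Rmin_left, Rmax_right by lra; exact Heq.
- apply (ex_RInt_continuous g); intros t _; apply Hg.
Qed.

(** [RInt_lt] asks for continuity up to the endpoints, so both functions are replaced by continuous
    extensions, which leaves the integrals unchanged. *)
Lemma RInt_lt_of_limits (f g : R -> R) (a b fa fb ga gb : R) :
  a < b ->
  (forall t, a < t < b -> continuous f t) ->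
  filterlim f (at_right a) (locally fa) ->
  filterlim f (at_left b) (locally fb) ->
  (forall t, a < t < b -> continuous g t) ->
  filterlim g (at_right a) (locally ga) ->
  filterlim g (at_left b) (locally gb) ->
  (forall t, a < t < b -> f t < g t) ->
  RInt f a b < RInt g a b.
Proof.
intros Hab Hf Hfa Hfb Hg Hga Hgb Hlt.
destruct (C0_extension_lt f fa fb a b Hab Hf Hfa Hfb) as [F [HF [HFeq _]]].
destruct (C0_extension_lt g ga gb a b Hab Hg Hga Hgb) as [G [HG [HGeq _]]].
rewrite <- (RInt_ext F f), <- (RInt_ext G g)
  by (rewrite Rmin_left, Rmax_right by lra; assumption).
apply RInt_lt; [exact Hab | intros t _; apply HG | intros t _; apply HF |].
intros t Ht; rewrite HFeq, HGeq by exact Ht; auto.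
Qed.

(** * Monotonicity and Lipschitz bound of the drift *)

Lemma erlangA_drift_antitone (lam mu theta c x y : R) :
  0 <= mu -> 0 <= theta -> x <= y ->
  erlangA_drift lam mu theta c y <= erlangA_drift lam mu theta c x.
Proof.
intros; unfold erlangA_drift, Rmin, Rmax.
destruct (Rle_dec x c), (Rle_dec y c), (Rle_dec (x - c) 0),
  (Rle_dec (y - c) 0); nra.
Qed.

(** The drift has slope [- mu] below [c] and [- theta] above it; [mu + theta] dominates both rates
    without a maximum. *)
Lemma erlangA_drift_lipschitz (lam mu theta c x y : R) :
  0 <= mu -> 0 <= theta -> x <= y ->
  erlangA_drift lam mu theta c x - erlangA_drift lam mu theta c y
  <= (mu + theta) * (y - x).
Proof.
intros; unfold erlangA_drift, Rmin, Rmax.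
destruct (Rle_dec x c), (Rle_dec y c), (Rle_dec (x - c) 0),
  (Rle_dec (y - c) 0); nra.
Qed.

(** * Trajectories with one impulse *)

Lemma impulse_trajectory_continuous (lam mu theta c b q0 tau : R)
    (q : R -> R) (t : R) :
  impulse_trajectory lam mu theta c b q0 tau q ->
  0 < t -> t <> tau -> continuous q t.
Proof.
intros H Ht Hne.
exact (is_derive_continuous _ _ _ (traj_ode _ _ _ _ _ _ _ _ H t Ht Hne)).
Qed.

(** An empty queue fills at once because the drift at 0 is [lam > 0]; a line of small positive slope
    through the origin stays below the trajectory. *)
Lemma impulse_trajectory_pos (lam mu theta c b q0 tau t : R) (q : R -> R) :
  0 < lam -> 0 <= mu -> 0 <= theta -> 0 < c -> 0 <= q0 ->
  impulse_trajectory lam mu theta c b q0 tau q ->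
  0 < t < tau -> 0 < q t.
Proof.
intros Hlam Hmu Htheta Hc Hq0 H Ht.
set (L := mu + theta).
set (k := lam / (1 + L * tau)).
assert (HL : 0 <= L * tau) by (unfold L; nra).
assert (Hk : 0 < k) by (apply Rdiv_lt_0_compat; lra).
(* [k] is small enough for the line [t |-> k t] to be a subsolution. *)
assert (Hkeq : k * (1 + L * tau) = lam) by (unfold k; field; lra).
enough (k * t <= q t) by nra.
apply (ode_comparison (erlangA_drift lam mu theta c)
         q (fun s => erlangA_drift lam mu theta c (q s))
         (fun s => k * s) (fun _ => k) 0 tau q0 (k * 0)); [.. | exact Ht].
- intros x y; apply erlangA_drift_antitone; assumption.
- intros s Hs; apply (traj_ode _ _ _ _ _ _ _ _ H); lra.
- intros; lra.
- intros s _; auto_derive; [exact I | ring].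
(* The Lipschitz bound makes the drift at [k * s] at least [lam - L * (k * s)], hence at least
   [lam - L * (k * tau) = k]. *)
- intros s Hs.
  assert (Hks : 0 <= k * s) by nra.
  pose proof (erlangA_drift_lipschitz lam mu theta c 0 (k * s)
                Hmu Htheta Hks) as Hlip.
  assert (H0 : erlangA_drift lam mu theta c 0 = lam).
  { unfold erlangA_drift; rewrite Rmin_left, Rmax_right by lra; ring. }
  assert (L * (k * s) <= L * (k * tau)).
  { apply Rmult_le_compat_l; [unfold L; lra |].
    apply Rmult_le_compat_l; lra. }
  fold L in Hlip; nra.
- rewrite <- (traj_init _ _ _ _ _ _ _ _ H).
  apply (traj_start _ _ _ _ _ _ _ _ H); lra.
- apply (continuous_at_right (fun s => k * s)).
  apply (ex_derive_continuous (fun s => k * s)); auto_derive; exact I.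
- lra.
Qed.

(** Before either impulse both functions solve the same equation from [q0], and comparison in both
    directions forces equality. *)
Lemma impulse_trajectory_unique_before (lam mu theta c b1 b2 q0 tau1 tau2 t : R)
    (q1 q2 : R -> R) :
  0 <= mu -> 0 <= theta ->
  impulse_trajectory lam mu theta c b1 q0 tau1 q1 ->
  impulse_trajectory lam mu theta c b2 q0 tau2 q2 ->
  0 < t < Rmin tau1 tau2 -> q1 t = q2 t.
Proof.
intros Hmu Htheta H1 H2 Ht.
pose proof (Rmin_l tau1 tau2); pose proof (Rmin_r tau1 tau2).
assert (Hf : forall x y, x <= y ->
          erlangA_drift lam mu theta c y <= erlangA_drift lam mu theta c x)
  by (intros; apply erlangA_drift_antitone; assumption).
assert (L1 : filterlim q1 (at_right 0) (locally q0)).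
{ rewrite <- (traj_init _ _ _ _ _ _ _ _ H1).
  apply (traj_start _ _ _ _ _ _ _ _ H1); lra. }
assert (L2 : filterlim q2 (at_right 0) (locally q0)).
{ rewrite <- (traj_init _ _ _ _ _ _ _ _ H2).
  apply (traj_start _ _ _ _ _ _ _ _ H2); lra. }
assert (D1 : forall s, 0 < s < Rmin tau1 tau2 ->
          is_derive q1 s (erlangA_drift lam mu theta c (q1 s)))
  by (intros; apply (traj_ode _ _ _ _ _ _ _ _ H1); lra).
assert (D2 : forall s, 0 < s < Rmin tau1 tau2 ->
          is_derive q2 s (erlangA_drift lam mu theta c (q2 s)))
  by (intros; apply (traj_ode _ _ _ _ _ _ _ _ H2); lra).
set (f := erlangA_drift lam mu theta c) in *.
apply Rle_antisym;
  [apply (ode_comparison f q2 (fun s => f (q2 s)) q1 (fun s => f (q1 s))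
            0 (Rmin tau1 tau2) q0 q0)
  |apply (ode_comparison f q1 (fun s => f (q1 s)) q2 (fun s => f (q2 s))
            0 (Rmin tau1 tau2) q0 q0)];
  auto; intros; apply Rle_refl.
Qed.

Lemma impulse_trajectory_left_limit (lam mu theta c b q0 tau t : R)
    (q : R -> R) :
  impulse_trajectory lam mu theta c b q0 tau q -> 0 < t ->
  exists l, filterlim q (at_left t) (locally l).
Proof.
intros H Ht; destruct (Req_dec t tau) as [-> | Hne].
- destruct (traj_jump _ _ _ _ _ _ _ _ H) as [qm [qp [[_ Hm] _]]].
  exists qm; auto.
- exists (q t).
  apply continuous_at_left, (impulse_trajectory_continuous _ _ _ _ _ _ _ _ _ H);
    assumption.
Qed.

Lemma impulse_trajectory_right_cont (lam mu theta c b q0 tau t : R)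
    (q : R -> R) :
  impulse_trajectory lam mu theta c b q0 tau q -> 0 <= t < tau ->
  filterlim q (at_right t) (locally (q t)).
Proof.
intros H Ht; destruct (Req_dec t 0) as [-> | Hne].
- apply (traj_start _ _ _ _ _ _ _ _ H); lra.
- apply continuous_at_right,
    (impulse_trajectory_continuous _ _ _ _ _ _ _ _ _ H); lra.
Qed.

(** The trajectory [u], with its impulse at [T], is the undisturbed reference on [[0, T)]. Since
    [v tau] is free when [tau > 0], the value before the jump is identified through the left limit
    of [u]. *)
Lemma impulse_trajectory_after (lam mu theta c b b' q0 tau T : R)
    (u v : R -> R) :
  0 <= mu -> 0 <= theta -> 0 <= tau < T ->
  impulse_trajectory lam mu theta c b' q0 T u ->
  impulse_trajectory lam mu theta c b q0 tau v ->
  filterlim v (at_right tau) (locally (b * u tau)).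
Proof.
intros Hmu Htheta Htau Hu Hv.
destruct (traj_jump _ _ _ _ _ _ _ _ Hv) as [qm [qp [[Hm0 Hm] [Hp Hj]]]].
assert (Hqm : qm = u tau).
{ destruct (Req_dec tau 0) as [E | E].
  - rewrite (Hm0 E), E, (traj_init _ _ _ _ _ _ _ _ Hu).
    apply (traj_init _ _ _ _ _ _ _ _ Hv).
  - assert (Hpos : 0 < tau) by lra.
    apply (@filterlim_locally_unique R R_AbsRing R_NormedModule
             (at_left tau) _ v); [auto |].
    apply (filterlim_ext_loc u).
    + apply at_left_interval with 0; [lra |]; intros s Hs.
      apply (impulse_trajectory_unique_before lam mu theta c b' b q0 T tau);
        auto.
      rewrite Rmin_right; lra.
    + apply continuous_at_left,
        (impulse_trajectory_continuous _ _ _ _ _ _ _ _ _ Hu); lra. }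
replace (b * u tau) with qp by (rewrite <- Hqm; lra).
exact Hp.
Qed.

Lemma ex_RInt_impulse_trajectory (lam mu theta c b q0 tau t : R) (q : R -> R) :
  impulse_trajectory lam mu theta c b q0 tau q -> 0 <= tau -> 0 <= t ->
  ex_RInt q 0 tau /\ ex_RInt q tau t.
Proof.
intros H Htau Ht.
assert (Hbefore : forall s, 0 <= s <= tau -> ex_RInt q 0 s).
{ intros s Hs; destruct (Req_dec s 0) as [-> | Hne]; [apply ex_RInt_point |].
  destruct (impulse_trajectory_left_limit _ _ _ _ _ _ _ s _ H) as [l Hl];
    [lra |].
  apply ex_RInt_of_limits with (q 0) l; [lra | | | exact Hl].
  - intros r Hr; apply (impulse_trajectory_continuous _ _ _ _ _ _ _ _ _ H); lra.
  - apply (traj_start _ _ _ _ _ _ _ _ H); lra. }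
split; [apply Hbefore; lra |].
(* If [t <= tau], the integral runs backwards inside [[0, tau]]; otherwise it starts from the value
   just after the impulse. *)
destruct (Rle_lt_dec t tau) as [Hle | Hlt].
- apply ex_RInt_Chasles with 0; [apply ex_RInt_swap |]; apply Hbefore; lra.
- destruct (impulse_trajectory_left_limit _ _ _ _ _ _ _ t _ H) as [l Hl];
    [lra |].
  destruct (traj_jump _ _ _ _ _ _ _ _ H) as [qm [qp [_ [Hp _]]]].
  apply ex_RInt_of_limits with qp l; [lra | | exact Hp | exact Hl].
  intros r Hr; apply (impulse_trajectory_continuous _ _ _ _ _ _ _ _ _ H); lra.
Qed.

(** * Comparison of the integrals and the optimal impulse time *)

(** The condition for strictness ensures [0 < u tau], hence [b * u tau < u tau]. A negative [b]
    sends [v] below zero, where the comparison still applies because the drift is antitone on the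
    whole line. *)
Lemma RInt_impulse_trajectory_le (lam mu theta c b b' q0 tau T : R)
    (u v : R -> R) :
  0 < lam -> 0 <= mu -> 0 <= theta -> 0 < c -> b < 1 -> 0 <= q0 ->
  0 <= tau < T ->
  impulse_trajectory lam mu theta c b' q0 T u ->
  impulse_trajectory lam mu theta c b q0 tau v ->
  RInt v 0 T <= RInt u 0 T /\
  (0 < tau \/ 0 < q0 -> RInt v 0 T < RInt u 0 T).
Proof.
intros Hlam Hmu Htheta Hc Hb Hq0 Htau Hu Hv.
assert (HT : 0 <= T) by lra.
assert (Htau0 : 0 <= tau) by lra.
destruct (ex_RInt_impulse_trajectory _ _ _ _ _ _ _ T _ Hv Htau0 HT) as [V1 V2].
(* The impulse of [u] is at [T], so the second integral obtained runs from [T] back to [tau] and has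
   to be reversed. *)
destruct (ex_RInt_impulse_trajectory _ _ _ _ _ _ _ tau _ Hu HT Htau0)
  as [U U'].
apply ex_RInt_swap in U'.
assert (U1 : ex_RInt u 0 tau)
  by (apply ex_RInt_Chasles with T; [exact U | apply ex_RInt_swap; exact U']).
assert (Hx : 0 < tau \/ 0 < q0 -> 0 < u tau).
{ intros H; destruct (Req_dec tau 0) as [E | E].
  - rewrite E, (traj_init _ _ _ _ _ _ _ _ Hu); lra.
  - apply (impulse_trajectory_pos lam mu theta c b' q0 T); auto; lra. }
assert (Hx0 : 0 <= u tau).
{ destruct (Req_dec tau 0) as [E | E].
  - rewrite E, (traj_init _ _ _ _ _ _ _ _ Hu); exact Hq0.
  - left; apply Hx; lra. }
assert (Lu := impulse_trajectory_right_cont _ _ _ _ _ _ _ _ _ Hu Htau).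
assert (Lv := impulse_trajectory_after _ _ _ _ _ _ _ _ _ _ _
                Hmu Htheta Htau Hu Hv).
assert (Du : forall t, tau < t < T ->
          is_derive u t (erlangA_drift lam mu theta c (u t)))
  by (intros; apply (traj_ode _ _ _ _ _ _ _ _ Hu); lra).
assert (Dv : forall t, tau < t < T ->
          is_derive v t (erlangA_drift lam mu theta c (v t)))
  by (intros; apply (traj_ode _ _ _ _ _ _ _ _ Hv); lra).
rewrite <- (RInt_Chasles v 0 tau T V1 V2), <- (RInt_Chasles u 0 tau T U1 U').
rewrite (RInt_ext v u 0 tau).
2:{ rewrite Rmin_left, Rmax_right by lra; intros t Ht.
    apply (impulse_trajectory_unique_before lam mu theta c b b' q0 tau T); auto.
    rewrite Rmin_left; lra. }
split; [apply Rplus_le_compat_l | intros H; apply Rplus_lt_compat_l].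
- apply RInt_le; auto; [lra |].
  set (f := erlangA_drift lam mu theta c) in *.
  apply (ode_comparison f u (fun s => f (u s)) v (fun s => f (v s))
           tau T (u tau) (b * u tau)); auto with real; [| nra].
  intros; apply erlangA_drift_antitone; auto.
- specialize (Hx H).
  destruct (impulse_trajectory_left_limit _ _ _ _ _ _ _ T _ Hu) as [lu Hlu];
    [lra |].
  destruct (impulse_trajectory_left_limit _ _ _ _ _ _ _ T _ Hv) as [lv Hlv];
    [lra |].
  apply RInt_lt_of_limits with (b * u tau) lv (u tau) lu; auto; [lra | | |].
  + intros t Ht; exact (is_derive_continuous _ _ _ (Dv t Ht)).
  + intros t Ht; exact (is_derive_continuous _ _ _ (Du t Ht)).
  + apply (ode_comparison_strict (erlangA_drift lam mu theta c) u v (mu + theta)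
             tau T (u tau) (b * u tau)); auto; [| | nra]; intros.
    * apply erlangA_drift_antitone; auto.
    * apply erlangA_drift_lipschitz; auto.
Qed.

Theorem theorem4p3 (lam mu theta c b q0 T : R)
    (hlam : 0 < lam) (hmu : 0 < mu) (htheta : 0 < theta) (hc : 0 < c)
    (hb : b < 1) (hq0 : 0 <= q0) (hT : 0 < T)
    (* [q tau] is the trajectory with the impulse at time [tau] *)
    (q : R -> R -> R)
    (hq : forall tau, 0 <= tau <= T ->
       impulse_trajectory lam mu theta c b q0 tau (q tau)) :
  let J := fun tau => average T (q tau) in
  let horizon := fun tau => 0 <= tau <= T in
  is_argmax horizon J T /\
  (* The only possible tie is an impulse at time 0 on an empty queue, which
     changes nothing. *)
  (forall tau, is_argmax horizon J tau -> tau = T \/ (tau = 0 /\ q0 = 0)).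
Proof.
intros J horizon.
assert (HT : horizon T) by (unfold horizon; lra).
assert (Hinv : 0 < / T) by (apply Rinv_0_lt_compat; exact hT).
assert (Hcmp : forall tau, 0 <= tau < T ->
          J tau <= J T /\ (0 < tau \/ 0 < q0 -> J tau < J T)).
{ intros tau Htau.
  destruct (RInt_impulse_trajectory_le lam mu theta c b b q0 tau T
              (q T) (q tau)) as [Hle Hlt]; try lra;
    [apply hq; exact HT | apply hq; lra |].
  split; [apply Rmult_le_compat_l; lra |].
  intros H; apply Rmult_lt_compat_l; auto. }
split.
- split; [exact HT |]; intros tau Htau.
  destruct (Req_dec tau T) as [-> | Hne]; [apply Rle_refl |].
  unfold horizon in Htau; apply Hcmp; lra.
- intros tau [Htau Hmax].
  destruct (Req_dec tau T) as [-> | Hne]; [left; reflexivity | right].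
  unfold horizon in Htau; destruct (Hcmp tau) as [_ Hlt]; [lra |].
  specialize (Hmax T HT).
  (* If [tau] or [q0] is positive, the strict inequality contradicts maximality; what remains is
     [tau = 0] and [q0 = 0]. *)
  destruct (Rle_lt_dec tau 0), (Rle_lt_dec q0 0); try lra;
    exfalso; (assert (J tau < J T) by (apply Hlt; auto)); lra.
Qed.
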